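(* Let $\mathcal{LT}$ be the free nonsymmetric operad, in the category of $\mathbb{Z}$-graded vector spaces over a field of characteristic $0$ with Koszul signs, generated by one ternary operation $t$ of odd homological degree, let $\alpha=t\circ_1 t+t\circ_2 t+t\circ_3 t$, and let $\mathcal{LT}/\langle\alpha\rangle$ be the ternary partially associative operad with an odd operation. Then for every weight $w\ge 0$ the dimension of the weight $w$ component (equivalently, the arity $2w+1$ component) of $\mathcal{LT}/\langle\alpha\rangle$ is the binary Catalan number, i.e. the number $$\frac{1}{w+1}\binom{2w}{w}$$ of plane binary trees with $w$ internal nodes.
   Context: A ternary tree is a rooted plane tree in which every node has either no children (a leaf) or exactly $3$ children (an internal node). The weight of a tree $p$ is its number $w(p)$ of internal nodes; its arity $\ell(p)=1+2w(p)$ is its number of leaves, indexed from left to right. The basic tree $t$ is the ternary tree of weight $1$. $\mathcal{LT}=\bigoplus_n\mathcal{LT}(n)$ ($n$ odd) is the free nonsymmetric operad on $t$ of odd degree. The parity $|p|\in\{0,1\}$ of a tree monomial $p$ is the parity of its weight. The partial compositions are bilinear and, for tree monomials $p,q,r$, satisfy $$(p\circ_i q)\circ_j r=\begin{cases} p\circ_i(q\circ_{j-i+1}r), & i\le j\le i+\ell(q)-1,\\ (-1)^{|q||r|}(p\circ_{j-\ell(q)+1}r)\circ_i q, & i+\ell(q)\le j\le \ell(p)+\ell(q)-1,\\ (-1)^{|q||r|}(p\circ_j r)\circ_{i+\ell(r)-1}q, & 1\le j\le i-1.\end{cases}$$ Every iterated partial composition of copies of $t$ corresponds to an underlying ternary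 tree (grafting at leaf $i$ for each $\circ_i$) and is determined by that tree up to sign; choosing one such composition for each tree of arity $n$ gives a basis of $\mathcal{LT}(n)$. The weight $w$ component of $\mathcal{LT}$ is the span of the trees of weight $w$, i.e. $\mathcal{LT}(2w+1)$. The ideal $\langle\alpha\rangle$ is the smallest homogeneous (i.e. direct sum of arity components) subspace $\mathcal{S}\subseteq\mathcal{LT}$ containing $\alpha$ such that $f\in\mathcal{S}(m)$, $g\in\mathcal{LT}(n)$ imply $f\circ_i g,\ g\circ_j f\in\mathcal{S}$ for all $1\le i\le m$, $1\le j\le n$. *)

(* Defs.v *)
From HB Require Import structures.
From mathcomp Require Import all_boot all_order all_algebra.
From mathcomp Require Import generic_quotient ring_quotient boolp.
From mathcomp Require Import zify.

Set Implicit Arguments.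
Unset Strict Implicit.
Unset Printing Implicit Defensive.

Import GRing.Theory.

Inductive tree := Leaf | Node of tree & tree & tree.

Fixpoint tree_code (p : tree) : GenTree.tree unit :=
  if p is Node a b c then
    GenTree.Node 0 [:: tree_code a; tree_code b; tree_code c]
  else GenTree.Leaf tt.

Fixpoint tree_decode (x : GenTree.tree unit) : option tree :=
  match x with
  | GenTree.Leaf _ => Some Leaf
  | GenTree.Node _ [:: x1; x2; x3] =>
      if (tree_decode x1, tree_decode x2, tree_decode x3)
        is (Some a, Some b, Some c) then Some (Node a b c) else None
  | _ => None
  end.

Lemma tree_codeK : pcancel tree_code tree_decode.
Proof. by elim=> //= a -> b -> c ->. Qed.

HB.instance Definition _ := Countable.copy tree (pcan_type tree_codeK).

Fixpoint weight (p : tree) : nat :=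
  if p is Node a b c then (weight a + weight b + weight c).+1 else 0.

Fixpoint arity (p : tree) : nat :=
  if p is Node a b c then arity a + arity b + arity c else 1.

Lemma arityE p : arity p = (2 * weight p).+1.
Proof. by elim: p => //= a -> b -> c ->; lia. Qed.

(* Leaves are numbered from 0, so [graft p i q] is the tree underlying the
   composition written p o_(i+1) q with leaves numbered from 1. *)
Fixpoint graft (p : tree) (i : nat) (q : tree) : tree :=
  if p is Node a b c then
    if i < arity a then Node (graft a i q) b c
    else if i < arity a + arity b then Node a (graft b (i - arity a) q) c
    else Node a b (graft c (i - arity a - arity b) q)
  else q.

(* The number of internal nodes of p that come after its leaf i in the
   left-to-right preorder traversal of p. *)
Fixpoint after (p : tree) (i : nat) : nat :=
  if p is Node a b c then
    if i < arity a then after a i + weight b + weight c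
    else if i < arity a + arity b then after b (i - arity a) + weight c
    else after c (i - arity a - arity b)
  else 0.

Lemma weight_graft p i q : weight (graft p i q) = (weight p + weight q)%N.
Proof.
elim: p i => //= a IHa b IHb c IHc i.
by case: ifP => _ /=; [|case: ifP => _ /=]; rewrite ?IHa ?IHb ?IHc; lia.
Qed.

Lemma arity_graft p i q : arity (graft p i q) = (arity p + arity q).-1.
Proof. by rewrite !arityE weight_graft; lia. Qed.

Lemma graft_seq p q r i j : i < arity p -> j < arity q ->
  graft (graft p i q) (i + j) r = graft p i (graft q j r).
Proof.
elim: p i => [|a IHa b IHb c IHc] i //= lti ltj; first by case: i lti.
have [lt_ia|le_ai] := ltnP i (arity a); rewrite /= ?arity_graft.
  by rewrite ifT ?IHa //; lia.
have [lt_ib|le_bi] := ltnP i (arity a + arity b); rewrite /= ?arity_graft.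
  have -> : (i + j - arity a = i - arity a + j)%N by lia.
  by rewrite ifF ?ifT ?IHb //; lia.
have -> : (i + j - arity a - arity b = i - arity a - arity b + j)%N by lia.
by rewrite !ifF ?IHc //; lia.
Qed.

Lemma after_seq p q i j : i < arity p -> j < arity q ->
  after (graft p i q) (i + j) = (after p i + after q j)%N.
Proof.
elim: p i => [|a IHa b IHb c IHc] i //= lti ltj; first by case: i lti.
have [lt_ia|le_ai] := ltnP i (arity a); rewrite /= ?arity_graft.
  by rewrite ifT ?IHa; lia.
have [lt_ib|le_bi] := ltnP i (arity a + arity b); rewrite /= ?arity_graft.
  have -> : (i + j - arity a = i - arity a + j)%N by lia.
  by rewrite ifF ?ifT ?IHb; lia.
have -> : (i + j - arity a - arity b = i - arity a - arity b + j)%N by lia.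
by rewrite !ifF ?IHc; lia.
Qed.

Lemma graft_par p q r i j : i < j < arity p ->
  graft (graft p i q) (j + arity q).-1 r = graft (graft p j r) i q.
Proof.
have r0 : 0 < arity r by rewrite arityE.
have q0 : 0 < arity q by rewrite !arityE.
elim: p i j => [|a IHa b IHb c IHc] i j /=; first by lia.
have a0 : 0 < arity a by rewrite arityE.
have b0 : 0 < arity b by rewrite arityE.
move=> ltij.
have [ja|ja] := ltnP j (arity a); have [ia|ia] := ltnP i (arity a);
  have [jb|jb] := ltnP j (arity a + arity b);
  have [ib|ib] := ltnP i (arity a + arity b); try lia;
  rewrite /= ?arity_graft ?weight_graft;
  do ?[case: ltnP => ?]; try lia.
- by rewrite IHa //; lia.
- by congr (Node _ (graft _ _ _) _); lia.
- by congr (Node _ _ (graft _ _ _)); lia.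
- by rewrite -IHb; [congr (Node _ (graft _ _ _) _) |]; lia.
- by congr (Node _ _ (graft _ _ _)); lia.
by rewrite -IHc; [congr (Node _ _ (graft _ _ _)) |]; lia.
Qed.

Lemma after_parr p q i j : i < j < arity p ->
  after (graft p i q) (j + arity q).-1 = after p j.
Proof.
have q0 : 0 < arity q by rewrite !arityE.
elim: p i j => [|a IHa b IHb c IHc] i j /=; first by lia.
have a0 : 0 < arity a by rewrite arityE.
have b0 : 0 < arity b by rewrite arityE.
move=> ltij.
have [ja|ja] := ltnP j (arity a); have [ia|ia] := ltnP i (arity a);
  have [jb|jb] := ltnP j (arity a + arity b);
  have [ib|ib] := ltnP i (arity a + arity b); try lia;
  rewrite /= ?arity_graft ?weight_graft;
  do ?[case: ltnP => ?]; try lia.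
- by rewrite IHa //; lia.
- by congr (after _ _ + _)%N; lia.
- by congr after; lia.
- by rewrite -(IHb (i - arity a)%N);
    [congr (after _ _ + _)%N | ]; lia.
- by congr after; lia.
by rewrite -(IHc (i - arity a - arity b)%N); [congr after |]; lia.
Qed.

Lemma after_parl p r i j : i < j < arity p ->
  after (graft p j r) i = (after p i + weight r)%N.
Proof.
have r0 : 0 < arity r by rewrite !arityE.
elim: p i j => [|a IHa b IHb c IHc] i j /=; first by lia.
have a0 : 0 < arity a by rewrite arityE.
have b0 : 0 < arity b by rewrite arityE.
move=> ltij.
have [ja|ja] := ltnP j (arity a); have [ia|ia] := ltnP i (arity a);
  have [jb|jb] := ltnP j (arity a + arity b);
  have [ib|ib] := ltnP i (arity a + arity b); try lia;
  rewrite /= ?arity_graft ?weight_graft;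
  do ?[case: ltnP => ?]; try lia.
- by rewrite IHa; lia.
- by rewrite IHb; lia.
by rewrite IHc; lia.
Qed.

Record tree_of (n : nat) := TreeOf { tval :> tree; tvalP : arity tval == n }.

HB.instance Definition _ n := [isSub for @tval n].
HB.instance Definition _ n := [Countable of tree_of n by <:].

Fixpoint trees_upto (h : nat) : seq tree :=
  if h is h'.+1 then
    let s := trees_upto h' in
    Leaf :: [seq Node a.1 a.2 c | a <- [seq (a, b) | a <- s, b <- s], c <- s]
  else [:: Leaf].

Lemma mem_trees_upto p h : weight p <= h -> p \in trees_upto h.
Proof.
elim: p h => [|a IHa b IHb c IHc] [|h] //= hw.
rewrite inE /=; apply: (allpairs_f (fun a c => Node a.1 a.2 c) (x := (a, b))).
  by apply: allpairs_f; [apply: IHa|apply: IHb]; lia.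
by apply: IHc; lia.
Qed.

Lemma weight_lt n (p : tree_of n) : weight p < n.
Proof. by have /eqP := tvalP p; rewrite arityE; lia. Qed.

Definition tree_of_enum n : seq (tree_of n) :=
  pmap insub (undup (trees_upto n)).

Lemma tree_of_enumP n : Finite.axiom (tree_of_enum n).
Proof.
apply: Finite.uniq_enumP; first by rewrite pmap_sub_uniq ?undup_uniq.
move=> p; rewrite mem_pmap_sub mem_undup mem_trees_upto //.
exact/ltnW/weight_lt.
Qed.

HB.instance Definition _ n := isFinite.Build (tree_of n) (@tree_of_enumP n).

Fact graft_of_subproof m n i (p : tree_of m) (q : tree_of n) :
  arity (graft p i q) == (m + n).-1.
Proof. by rewrite arity_graft (eqP (tvalP p)) (eqP (tvalP q)). Qed.

Definition graft_of m n i (p : tree_of m) (q : tree_of n) :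
  tree_of (m + n).-1 := TreeOf (graft_of_subproof i p q).

Local Open Scope ring_scope.

Section VspaceQuotient.
Variables (K : fieldType) (V : vectType K) (U : {vspace V}).

Definition quotv := Quotient.quot (pred_of_vspace U).
HB.instance Definition _ := GRing.Zmodule.on quotv.

Definition quotv_pi (v : V) : quotv := (\pi v)%qT.
Definition quotv_repr (x : quotv) : V := repr x.

Lemma quotv_reprK : cancel quotv_repr quotv_pi.
Proof. exact: reprK. Qed.

Lemma quotv_piP u v : reflect (quotv_pi u = quotv_pi v) (u - v \in U).
Proof. by rewrite (Quotient.idealrBE (pred_of_vspace U)); apply: (iffP eqP). Qed.

Lemma quotv_piD : {morph quotv_pi : u v / u + v}.
Proof. by move=> u v; rewrite /quotv_pi raddfD. Qed.

Lemma quotv_repr_pi v : quotv_repr (quotv_pi v) - v \in U.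
Proof. by apply/quotv_piP; rewrite quotv_reprK. Qed.

Definition quotv_scale (a : K) (x : quotv) : quotv :=
  quotv_pi (a *: quotv_repr x).

Lemma quotv_scale_pi a v : quotv_scale a (quotv_pi v) = quotv_pi (a *: v).
Proof. by apply/quotv_piP; rewrite -scalerBr memvZ ?quotv_repr_pi. Qed.

Lemma quotv_scaleA a b x :
  quotv_scale a (quotv_scale b x) = quotv_scale (a * b) x.
Proof. by rewrite -[x]quotv_reprK !quotv_scale_pi scalerA. Qed.

Lemma quotv_scale1 : left_id 1 quotv_scale.
Proof. by move=> x; rewrite -[x]quotv_reprK quotv_scale_pi scale1r. Qed.

Lemma quotv_scaleDr : right_distributive quotv_scale +%R.
Proof.
move=> a x y; rewrite -[x]quotv_reprK -[y]quotv_reprK -quotv_piD.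
by rewrite !quotv_scale_pi scalerDr quotv_piD.
Qed.

Lemma quotv_scaleDl x : {morph quotv_scale^~ x : a b / a + b}.
Proof.
by move=> a b; rewrite -[x]quotv_reprK !quotv_scale_pi scalerDl quotv_piD.
Qed.

HB.instance Definition _ := GRing.Zmodule_isLmodule.Build K quotv
  quotv_scaleA quotv_scale1 quotv_scaleDr quotv_scaleDl.

Lemma quotv_pi_linear : linear quotv_pi.
Proof. by move=> a u v; rewrite quotv_piD -quotv_scale_pi. Qed.

Fact quotv_vect_iso : Vector.axiom (\dim U^C) quotv.
Proof.
have cap0 : (U^C :&: U = 0)%VS by rewrite capvC capv_compl.
have full v : v \in (U^C + U)%VS by rewrite addvC addv_complf memvf.
pose pr := daddv_pi U^C U.
have prU u : u \in U -> pr u = 0.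
  move=> Uu; have := daddv_pi_add cap0 (full u).
  rewrite (daddv_pi_id _ Uu) 1?capvC // => pr_u.
  by apply: (addIr u); rewrite add0r.
have pr_repr v : pr (quotv_repr (quotv_pi v)) = pr v.
  have := prU _ (quotv_repr_pi v); rewrite linearB => /eqP.
  by rewrite subr_eq0 => /eqP.
have [f linf bijf] := subvs_vect_iso U^C.
exists (fun x => f (vsproj U^C (pr (quotv_repr x)))).
  move=> a x y; rewrite -linf -linearP -linearP.
  by rewrite -{1}[x]quotv_reprK -{1}[y]quotv_reprK -quotv_pi_linear pr_repr.
case: bijf => g fK gK; exists (fun r => quotv_pi (vsval (g r))) => [x|r].
  rewrite fK vsprojK ?memv_pi // -[RHS]quotv_reprK; apply/quotv_piP.
  rewrite -opprB memvN -{1}[quotv_repr x](daddv_pi_add cap0) //.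
  by rewrite addrC addKr memv_pi.
by rewrite pr_repr /pr daddv_pi_id ?subvsP // vsvalK gK.
Qed.

HB.instance Definition _ := Lmodule_hasFinDim.Build K quotv quotv_vect_iso.

Lemma dim_quotv : \dim {: quotv} = (\dim {: V} - \dim U)%N.
Proof. by rewrite dimvf -dimv_compl. Qed.

End VspaceQuotient.

Section FreeOperad.

Variable F : fieldType.

(* There is no tree of even arity, so LT n is 0 for even n. *)
Definition LT (n : nat) := {ffun tree_of n -> F^o}.

HB.instance Definition _ n := Vector.on (LT n).

(* The composition of copies of the generator with underlying tree p in which
   the copies are taken in the preorder of the nodes of p.  This is the choice
   of one composition for each tree that makes the monomials a basis. *)
Definition mono n (p : tree_of n) : LT n := [ffun q => (q == p)%:R].

(* Writing the copies of the generator in p, then those in q, and sorting them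
   into the preorder of the grafted tree moves each of the [weight q] copies in
   q past the [after p i] copies of p that follow leaf i; the generator is odd,
   so each transposition contributes -1.  Leaves are numbered from 0. *)
Definition pcomp m n (i : 'I_m) (f : LT m) (g : LT n) : LT (m + n).-1 :=
  \sum_(p : tree_of m) \sum_(q : tree_of n)
    ((-1) ^+ (weight q * after p i) * f p * g q) *: mono (graft_of i p q).

Lemma LT_sum n (f : LT n) : f = \sum_p f p *: mono p.
Proof.
apply/ffunP=> q; rewrite sum_ffunE (bigD1 q) //= big1 => [|p /negPf neq_pq].
  by rewrite !ffunE eqxx addr0 [_ *: _]mulr1.
by rewrite !ffunE eq_sym neq_pq scaler0.
Qed.

Lemma pcomp_linearl m n (i : 'I_m) (g : LT n) :
  linear (fun f : LT m => pcomp i f g).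
Proof.
move=> a f f'; rewrite scaler_sumr -big_split /=; apply: eq_bigr => p _.
rewrite scaler_sumr -big_split /=; apply: eq_bigr => q _.
rewrite !ffunE scalerA -scalerDl; congr (_ *: _).
by rewrite [a *: f p]/(a * f p) mulrDr mulrDl !mulrA (mulrC a).
Qed.

Lemma pcomp_linearr m n (i : 'I_m) (f : LT m) : linear (@pcomp m n i f).
Proof.
move=> a g g'; rewrite scaler_sumr -big_split /=; apply: eq_bigr => p _.
rewrite scaler_sumr -big_split /=; apply: eq_bigr => q _.
rewrite !ffunE scalerA -scalerDl; congr (_ *: _).
by rewrite [a *: g q]/(a * g q) mulrDr mulrCA.
Qed.

Lemma pcomp_mono m n (i : 'I_m) (p : tree_of m) (q : tree_of n) :
  pcomp i (mono p) (mono q) =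
  (-1) ^+ (weight q * after p i) *: mono (graft_of i p q).
Proof.
rewrite /pcomp (bigD1 p) //= [X in _ + X]big1 => [|p' /negPf neq_p]; last first.
  by apply: big1 => q' _; rewrite ffunE neq_p mulr0 mul0r scale0r.
rewrite (bigD1 q) //= [X in _ + X + _]big1 => [|q' /negPf neq_q]; last first.
  by rewrite [mono q _]ffunE neq_q mulr0 scale0r.
by rewrite !ffunE !eqxx !mulr1 !addr0.
Qed.

Definition castLT m n (e : m = n) (f : LT m) : LT n := ecast k (LT k) e f.

Lemma castLT_linear m n (e : m = n) : linear (castLT e).
Proof. by case: n / e. Qed.

Lemma castLT_mono m n (e : m = n) (p : tree_of m) (q : tree_of n) :
  p = q :> tree -> castLT e (mono p) = mono q.
Proof. by case: n / e q => q /val_inj->. Qed.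

Lemma trilinear_ext m n k d (A B : LT m -> LT n -> LT k -> LT d) :
    (forall g h, linear (fun f => A f g h)) ->
    (forall f h, linear (fun g => A f g h)) ->
    (forall f g, linear (A f g)) ->
    (forall g h, linear (fun f => B f g h)) ->
    (forall f h, linear (fun g => B f g h)) ->
    (forall f g, linear (B f g)) ->
    (forall p q r, A (mono p) (mono q) (mono r) = B (mono p) (mono q) (mono r)) ->
  forall f g h, A f g h = B f g h.
Proof.
have ext x (u v : LT x -> LT d) : linear u -> linear v ->
    (forall p, u (mono p) = v (mono p)) -> u =1 v.
  move=> linu linv uv f.
  pose ul := GRing.isLinear.Build _ _ _ _ u linu.
  pose vl := GRing.isLinear.Build _ _ _ _ v linv.
  pose u' : {linear _ -> _} := HB.pack u ul.
  pose v' : {linear _ -> _} := HB.pack v vl.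
  rewrite -[u f]/(u' f) -[v f]/(v' f) (LT_sum f) !linear_sum.
  by apply: eq_bigr => p _; rewrite !linearZ /= uv.
move=> A1 A2 A3 B1 B2 B3 AB f g h.
apply: (ext _ (fun f => A f g h) (fun f => B f g h)) => // p.
apply: (ext _ (fun g => A _ g h) (fun g => B _ g h)) => // q.
by apply: ext => // r; apply: AB.
Qed.

(* [pcomp_seq] and [pcomp_par] are the axioms of a nonsymmetric operad with
   Koszul signs: an element of LT n has the parity of n./2, the weight of the
   trees of arity n.  The case where r is grafted to the left of q is
   [pcomp_par] read from right to left. *)
Lemma pcomp_seq m n k (i : 'I_m) (j : 'I_n) (l : 'I_(m + n).-1)
    (e : (m + (n + k).-1).-1 = ((m + n).-1 + k).-1)
    (f : LT m) (g : LT n) (h : LT k) :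
  l = (i + j)%N :> nat ->
  pcomp l (pcomp i f g) h = castLT e (pcomp i f (pcomp j g h)).
Proof.
move=> lE; move: f g h; apply: trilinear_ext.
- by move=> g h a f f'; rewrite !pcomp_linearl.
- by move=> f h a g g'; rewrite pcomp_linearr pcomp_linearl.
- by move=> f g; apply: pcomp_linearr.
- by move=> g h a f f'; rewrite pcomp_linearl castLT_linear.
- by move=> f h a g g'; rewrite pcomp_linearl pcomp_linearr castLT_linear.
- by move=> f g a h h'; rewrite !pcomp_linearr castLT_linear.
move=> p q r; have [lip ljq] : (i < arity p)%N /\ (j < arity q)%N.
  by rewrite (eqP (tvalP p)) (eqP (tvalP q)).
rewrite !pcomp_mono (GRing.scalable_linear (pcomp_linearl l _)).
rewrite (GRing.scalable_linear (pcomp_linearr i _)).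
rewrite !(GRing.scalable_linear (castLT_linear e)).
rewrite !pcomp_mono (GRing.scalable_linear (castLT_linear e)).
rewrite (castLT_mono e (q := graft_of l (graft_of i p q) r)) /=; last first.
  by rewrite lE graft_seq.
rewrite !scalerA -!exprD; congr (_ ^+ _ *: _).
by rewrite lE after_seq // weight_graft; lia.
Qed.

Lemma pcomp_par m n k (i j : 'I_m) (l : 'I_(m + n).-1) (l' : 'I_(m + k).-1)
    (e : ((m + k).-1 + n).-1 = ((m + n).-1 + k).-1)
    (f : LT m) (g : LT n) (h : LT k) :
  (i < j)%N -> l = (j + n).-1 :> nat -> l' = i :> nat ->
  pcomp l (pcomp i f g) h =
  (-1) ^+ (n./2 * k./2) *: castLT e (pcomp l' (pcomp j f h) g).
Proof.
move=> ltij lE lE'; move: f g h; apply: trilinear_ext.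
- by move=> g h a f f'; rewrite !pcomp_linearl.
- by move=> f h a g g'; rewrite pcomp_linearr pcomp_linearl.
- by move=> f g; apply: pcomp_linearr.
- move=> g h a f f'; rewrite !pcomp_linearl castLT_linear scalerDr.
  by rewrite !scalerA mulrC.
- move=> f h a g g'; rewrite pcomp_linearr castLT_linear scalerDr.
  by rewrite !scalerA mulrC.
- move=> f g a h h'; rewrite pcomp_linearr pcomp_linearl castLT_linear scalerDr.
  by rewrite !scalerA mulrC.
move=> p q r; have ltijp : (i < j < arity p)%N.
  by rewrite ltij (eqP (tvalP p)) ltn_ord.
have Eq := eqP (tvalP q); have Er := eqP (tvalP r).
have lq : l = (j + arity q).-1 :> nat by rewrite Eq.
have [wq wr] : weight q = n./2 /\ weight r = k./2.
  by move: (arityE q) (arityE r); rewrite Eq Er; lia.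
rewrite !pcomp_mono (GRing.scalable_linear (pcomp_linearl l _)).
rewrite (GRing.scalable_linear (pcomp_linearl l' _)).
rewrite !(GRing.scalable_linear (castLT_linear e)).
rewrite !pcomp_mono (GRing.scalable_linear (castLT_linear e)).
rewrite (castLT_mono e (q := graft_of l (graft_of i p q) r)) /=; last first.
  by rewrite lq lE' graft_par.
rewrite !scalerA -!exprD lq lE' after_parr // after_parl // wq wr.
congr (_ *: _); rewrite -[LHS]signr_odd -[RHS]signr_odd; congr (_ ^+ _).
by rewrite !(oddD, oddM); case: (odd n./2); case: (odd k./2);
  case: (odd (after p i)); case: (odd (after p j)).
Qed.

Definition LTgen : LT 3 := mono (@TreeOf 3 (Node Leaf Leaf Leaf) isT).

Definition alpha : LT 5 :=
  pcomp (0 : 'I_3) LTgen LTgen + pcomp (1 : 'I_3) LTgen LTgen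
    + pcomp (2 : 'I_3) LTgen LTgen.

(* S stands for the homogeneous subspace with components S n. *)
Definition is_ideal (S : forall n, {vspace LT n}) : Prop :=
  forall m n (f : LT m) (g : LT n), f \in S m ->
    (forall i : 'I_m, pcomp i f g \in S (m + n).-1) /\
    (forall j : 'I_n, pcomp j g f \in S (n + m).-1).

Definition least_ideal k (a : LT k) (S : forall n, {vspace LT n}) : Prop :=
  [/\ is_ideal S, a \in S k &
      forall S', is_ideal S' -> a \in S' k -> forall n, (S n <= S' n)%VS].

Lemma least_ideal_ex k (a : LT k) : exists S, least_ideal a S.
Proof.
pose P n (d : nat) := `[< exists S : forall n, {vspace LT n},
  [/\ is_ideal S, a \in S k & \dim (S n) = d] >].
have exP n : exists d, P n d.
  exists (\dim {: LT n}); apply/asboolP; exists (fun n => fullv).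
  by split=> // *; [split=> *; rewrite memvf | rewrite memvf].
have minP n : exists S : forall n, {vspace LT n}, [/\ is_ideal S, a \in S k &
    forall S', is_ideal S' -> a \in S' k -> (S n <= S' n)%VS].
  case: (ex_minnP (exP n)) => d /asboolP[S [idS Sa dS]] dmin.
  exists S; split=> // S' idS' S'a.
  have /dmin : P n (\dim (S n :&: S' n)).
    apply/asboolP; exists (fun n => S n :&: S' n)%VS; split=> //.
      move=> m p f g /memv_capP[Sf S'f]; split=> i; rewrite memv_cap.
        by rewrite (idS _ _ _ _ Sf).1 (idS' _ _ _ _ S'f).1.
      by rewrite (idS _ _ _ _ Sf).2 (idS' _ _ _ _ S'f).2.
    by rewrite memv_cap Sa.
  rewrite -dS => le_d.
  have /eqP <- : (S n :&: S' n)%VS == S n by rewrite eqEdim capvSl.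
  exact: capvSr.
have [S SP] := choice minP.
exists (fun n => S n n); split; last first.
- by move=> S' idS' S'a n; case: (SP n) => _ _; apply.
- by case: (SP k).
move=> m n f g Sf.
have Sf' p : f \in S p m.
  by case: (SP m) (SP p) => _ _ sub [? ? _]; apply: subvP Sf; apply: sub.
split=> i.
  by case: (SP (m + n).-1) => idS _ _; case: (idS _ _ _ g (Sf' (m + n).-1)).
by case: (SP (n + m).-1) => idS _ _; case: (idS _ _ _ g (Sf' (n + m).-1)).
Qed.

Definition ideal k (a : LT k) : forall n, {vspace LT n} :=
  sval (cid (least_ideal_ex a)).

Lemma idealP k (a : LT k) : least_ideal a (ideal a).
Proof. exact: svalP. Qed.

(* The arity n component of the quotient by the ideal generated by alpha. *)
Definition LTquot n := quotv (ideal alpha n).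
HB.instance Definition _ n := Vector.on (LTquot n).

End FreeOperad.

(* Main.v *)
From HB Require Import structures.
From mathcomp Require Import all_boot all_order all_algebra.
From mathcomp Require Import boolp zify ring.
Require Import Defs.

(** Modulo [alpha], a left comb [t o_1 t] can be rewritten as
    [- t o_2 t - t o_3 t].  This moves internal nodes to the right, so every
    monomial reduces to a combination of _normal_ trees, those in which the
    first child of every internal node is a leaf.  In each arity, the ideal and
    the span of the normal trees add up to the whole space
    ([ideal_normals_full]).  Erasing the first children turns normal trees of
    weight w into plane binary trees with w internal nodes, which the Catalan
    number counts ([catalan]).

    It remains to see that no nonzero combination of normal trees lies in the
    ideal ([ideal_normals0]).  The only overlap of [t o_1 t] with itself is the
    left comb of weight 3, so this is the confluence of one critical pair.  It is
    proved here by making the span V of all binary trees into an algebra over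
    the quotient operad: the ternary product of binary trees has
    [ L y z := (y z) ] when the first factor is the one-leaf tree [L], and
    [ (x1 x2) y z := - ((x1 x2 y) z) - (-1)^|x1| (x1 (x2 y z)) ],
    where the products of three factors on the right are again this ternary
    product.  The case of a leaf as first factor of
    [ (a b c) d e + (-1)^|a| a (b c d) e + (-1)^(|a|+|b|) a b (c d e) = 0 ]
    is then the definition of the product, and the case [a = (x y)] reduces to
    the instances for [x] and [y], all other terms cancelling; so the identity
    holds by induction on [a] ([tprod_partial_assoc]).  Hence the operations
    that vanish on V form an ideal that contains [alpha], and therefore the
    whole ideal of [alpha] ([ideal_signed_eval]).  But a normal tree evaluated
    at one-leaf trees returns the binary tree that it encodes, so these
    evaluations read off the coefficients of a combination of normal trees.

    To avoid an infinite-dimensional V, an element of V is represented by the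
    functional that it induces on functions [h : btree -> F]; multilinear
    operations are then written in continuation-passing style, and [x] in V
    stands for [h |-> h x]. *)

Set Implicit Arguments.
Unset Strict Implicit.
Unset Printing Implicit Defensive.

Import GRing.Theory.

(** * Counting normal trees *)

Fixpoint normal (p : tree) : bool :=
  match p with
  | Leaf => true
  | Node Leaf b c => normal b && normal c
  | _ => false
  end.

Definition merge_roots (s : seq tree) : seq tree :=
  if s is x :: y :: s' then Node Leaf x y :: s' else s.

(** Ordered forests of [k] normal trees with [n] leaves in all, by the first
    letter of their preorder word: either the first tree is a leaf, or it splits
    into two, which costs its leading leaf.  Both cases use up one leaf, hence
    the structural recursion on [n]. *)
Fixpoint forests (n k : nat) : seq (seq tree) :=
  match n, k with
  | 0, 0 => [:: [::]]
  | n'.+1, k'.+1 =>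
      map (cons Leaf) (forests n' k') ++ map merge_roots (forests n' k'.+2)
  | _, _ => [::]
  end.

Lemma arity_gt0 p : 0 < arity p.
Proof. by rewrite arityE. Qed.

Lemma mem_forests n k s : (s \in forests n k) =
  [&& size s == k, all normal s & sumn (map arity s) == n].
Proof.
elim: n k s => [|n IHn] [|k] [|p s] //=.
- by rewrite addn_eq0 (gtn_eqF (arity_gt0 p)) !andbF.
- rewrite mem_cat; apply/negbTE/norP; split; apply/mapP=> -[[|x [|y s]]] //.
  by rewrite IHn.
rewrite mem_cat eqSS.
have E1 : (p :: s \in map (cons Leaf) (forests n k)) =
    (p == Leaf) && (s \in forests n k).
  apply/mapP/andP=> [[s' s'F [-> ->]]|[/eqP-> sF]]; last by exists s.
  by rewrite eqxx.
have E2 : (p :: s \in map merge_roots (forests n k.+2)) =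
    match p with
    | Node Leaf x y => x :: y :: s \in forests n k.+2
    | _ => false
    end.
  apply/mapP/idP=> [[[|x [|y s']]]|]; try by rewrite IHn.
    by move=> s'F [-> ->].
  by case: p {E1} => [|[|? ? ?] x y] // sF; exists (x :: y :: s).
rewrite E1 E2 {E1 E2}; case: p => [|[|a1 a2 a3] x y] /=.
- by rewrite orbF IHn add1n eqSS.
- by rewrite IHn /= !eqSS [in LHS]addnA [in X in _ && X]andbA.
- by rewrite andbF.
Qed.

Lemma forests_uniq n k : uniq (forests n k).
Proof.
elim: n k => [|n IHn] [|k] //=; rewrite cat_uniq; apply/and3P; split.
- by rewrite map_inj_uniq // => s s' [].
- apply/hasPn=> s /mapP[[|x [|y s']]]; rewrite mem_forests //= => _ ->.
  by apply/mapP=> -[].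
rewrite map_inj_in_uniq // => -[|x [|y s]] [|x' [|y' s']];
  by rewrite !mem_forests //= => _ _ [-> -> ->].
Qed.

Lemma forests_lt n k : n < k -> forests n k = [::].
Proof. by elim: n k => [|n IHn] [|k] //= lt_nk; rewrite !IHn //; lia. Qed.

Lemma size_forestsS n k : size (forests n.+1 k.+1) =
  size (forests n k) + size (forests n k.+2).
Proof. by rewrite /= size_cat !size_map. Qed.

Lemma size_forests_diag k : size (forests k k) = 1.
Proof. by elim: k => // k IHk; rewrite size_forestsS IHk forests_lt. Qed.

(** The ballot numbers in the form of the reflection principle,
    [C(2w + k + 1, w + 1) - C(2w + k + 1, w)] for total weight [w + 1]: in this
    form the recursion of [forests] becomes Pascal's rule. *)
Lemma size_forests w k :
  size (forests (2 * w.+1 + k) k) + 'C((2 * w + k).+1, w) =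
    'C((2 * w + k).+1, w.+1).
Proof.
have [m] := ubnP (2 * w.+1 + k); elim: m w k => // m IHm w [|k] le_m.
  rewrite addn0 -[2 * w.+1]prednK //= add0n addn0 -[RHS]bin_sub; last by lia.
  by congr 'C(_, _); lia.
rewrite addnS size_forestsS; have := IHm w k; case: w le_m => [|w] le_m.
  by rewrite -[2 * 1 + k]/k.+2 size_forests_diag !bin0 !bin1; lia.
have := IHm w k.+2; have -> : 2 * w.+1 + k.+2 = 2 * w.+2 + k by lia.
have -> : (2 * w + k.+2).+1 = (2 * w.+1 + k).+1 by lia.
rewrite addnS; move: (binS (2 * w.+1 + k).+1 w).
by move: (binS (2 * w.+1 + k).+1 w.+1); lia.
Qed.

Lemma catalan w : w.+1 * size (forests (2 * w).+1 1) = 'C(2 * w, w).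
Proof.
case: w => [//|w]; have := size_forests w 1.
have -> : 2 * w.+1 + 1 = (2 * w.+1).+1 by lia.
have -> : (2 * w + 1).+1 = 2 * w.+1 by lia.
have := mul_bin_left (2 * w.+1) w.
have -> : 2 * w.+1 - w = w.+2 by lia.
nia.
Qed.

Lemma card_normal n : #|[pred p : tree_of n | normal p]| = size (forests n 1).
Proof.
rewrite cardE -(size_map (@Defs.tval n)) -(size_map (head Leaf) (forests n 1)).
apply/perm_size/uniq_perm.
- by rewrite map_inj_uniq ?enum_uniq //; apply: val_inj.
- rewrite map_inj_in_uniq ?forests_uniq // => -[|x [|? ?]] [|y [|? ?]];
  by rewrite !mem_forests //= => _ _ ->.
move=> p; apply/mapP/mapP=> [[q qN ->]|[[|x [|? ?]]]].
- move: qN; rewrite mem_enum inE => qN; exists [:: val q] => //.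
  by rewrite mem_forests /= qN addn0 (tvalP q).
- by rewrite mem_forests.
- rewrite mem_forests /= addn0 andbT => /andP[xN xn] ->.
  by exists (TreeOf xn) => //; rewrite mem_enum.
by rewrite mem_forests.
Qed.

Local Open Scope ring_scope.

(** * Binary trees and finite combinations *)

Inductive btree := BLeaf | BNode of btree & btree.

Fixpoint bweight (x : btree) : nat :=
  if x is BNode y z then (bweight y + bweight z).+1 else 0.

Fixpoint ternary_of (x : btree) : tree :=
  if x is BNode y z then Node Leaf (ternary_of y) (ternary_of z) else Leaf.

Lemma normalP p : normal p -> exists x, p = ternary_of x.
Proof.
elim: p => [|[|? ? ?] _ b IHb c IHc] //; first by exists BLeaf.
by case/andP=> /IHb[x ->] /IHc[y ->]; exists (BNode x y).
Qed.

(** A subspace given by infinitely many linear conditions: take a subspace of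
    maximal dimension among those contained in [P]. *)
Lemma vspace_of_pred (K : fieldType) (V : vectType K) (P : V -> Prop) :
    P 0 -> (forall a u v, P u -> P v -> P (a *: u + v)) ->
  exists U : {vspace V}, forall v, v \in U <-> P v.
Proof.
move=> P0 Plin.
pose Q d := `[< exists2 U : {vspace V}, (forall v, v \in U -> P v) &
  \dim U = d >].
have exQ : exists d, Q d.
  exists 0%N; apply/asboolP; exists 0%VS; rewrite ?dimv0 // => v.
  by rewrite memv0 => /eqP->.
have boundQ d : Q d -> (d <= \dim {: V})%N.
  by move=> /asboolP[U _ <-]; rewrite dimvS ?subvf.
case: (ex_maxnP exQ boundQ) => d /asboolP[U UP <-] maxU.
exists U => v; split=> [/UP //|Pv].
have /maxU leU : Q (\dim (U + <[v]>)).
  apply/asboolP; exists (U + <[v]>)%VS => //.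
  move=> _ /memv_addP[u uU [_ /vlineP[a ->] ->]].
  by rewrite addrC; apply: Plin => //; apply: UP.
have /eqP-> : U == (U + <[v]>)%VS by rewrite eqEdim addvSl.
by rewrite (subvP (addvSr _ _)) ?memv_line.
Qed.

Section Model.
Variable F : fieldType.
Implicit Types (v : nat -> btree).

(** The functionals that stand for elements of the free vector space on [T]. *)
Definition combination (T : Type) (phi : (T -> F) -> F) : Prop :=
  exists s : seq (F * T), forall h : T -> F, phi h = \sum_(c <- s) c.1 * h c.2.

Lemma combination_eval (T : Type) (x : T) : combination (fun h : T -> F => h x).
Proof. by exists [:: (1, x)] => h; rewrite big_seq1 mul1r. Qed.

Lemma combinationD (T : Type) (phi psi : (T -> F) -> F) :
  combination phi -> combination psi -> combination (fun h => phi h + psi h).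
Proof.
by case=> s phiE [s' psiE]; exists (s ++ s') => h; rewrite big_cat -phiE -psiE.
Qed.

Lemma combinationZ (T : Type) (a : F) (phi : (T -> F) -> F) :
  combination phi -> combination (fun h => a * phi h).
Proof.
case=> s phiE; exists [seq (a * c.1, c.2) | c <- s] => h.
by rewrite big_map phiE mulr_sumr; apply: eq_bigr => c _; rewrite mulrA.
Qed.

Lemma combination_bind (T U : Type) phi (psi : T -> (U -> F) -> F) :
    combination phi -> (forall x, combination (psi x)) ->
  combination (fun h => phi (psi^~ h)).
Proof.
case=> s phiE psiP; suff: combination (fun h => \sum_(c <- s) c.1 * psi c.2 h).
  by case=> s' E; exists s' => h; rewrite phiE E.
elim: s {phiE} => [|c s [s' IHs]].
  by exists [::] => h; rewrite !big_nil.
have [t E] := combinationD (combinationZ c.1 (psiP c.2))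
  (ex_intro _ s' (fun h => erefl (\sum_(c <- s') c.1 * h c.2))).
by exists t => h; rewrite big_cons IHs E.
Qed.

Lemma combination_linear (T : Type) phi (a b : F) (h h' : T -> F) :
  combination phi ->
  phi (fun x => a * h x + b * h' x) = a * phi h + b * phi h'.
Proof.
case=> s phiE; rewrite !phiE !mulr_sumr -big_split.
by apply: eq_bigr => c _; rewrite /=; ring.
Qed.

Lemma combination_sum (T : Type) (I : finType) phi (a : I -> F)
    (k : I -> T -> F) :
  combination phi ->
  phi (fun x => \sum_i a i * k i x) = \sum_i a i * phi (k i).
Proof.
case=> s phiE; rewrite phiE; under [RHS]eq_bigr do rewrite phiE mulr_sumr.
rewrite exchange_big; apply: eq_bigr => c _; rewrite mulr_sumr.
by apply: eq_bigr => i _; rewrite mulrCA.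
Qed.

Lemma combination_scale (T : Type) phi (a : F) (k : T -> F) :
  combination phi -> phi (fun x => a * k x) = a * phi k.
Proof.
case=> s phiE; rewrite !phiE mulr_sumr.
by apply: eq_bigr => c _; rewrite mulrCA.
Qed.

(** In continuation-passing style the order of two independent arguments is
    visible; this lemma makes it irrelevant. *)
Lemma combination_exchange (T U : Type) phi psi (k : T -> U -> F) :
    combination phi -> combination psi ->
  phi (fun x => psi (k x)) = psi (fun y => phi (k^~ y)).
Proof.
case=> s phiE [s' psiE]; rewrite phiE psiE.
under eq_bigr do rewrite psiE mulr_sumr.
rewrite exchange_big; apply: eq_bigr => c _; rewrite phiE mulr_sumr.
by apply: eq_bigr => d _; rewrite mulrCA.
Qed.

(** * The partially associative product on binary trees *)

Definition sgn (n : nat) : F := (-1) ^+ n.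

Lemma sgnD m n : sgn (m + n) = sgn m * sgn n.
Proof. exact: exprD. Qed.

Lemma sgnS n : sgn n.+1 = - sgn n.
Proof. by rewrite /sgn exprS mulN1r. Qed.

(** The element [x y z] of V, applied to [h].  The clause for [BNode x1 x2] is
    the rewriting of [t o_1 t], whose second term moves the odd operation past
    [x1]. *)
Fixpoint tprod (x y z : btree) (h : btree -> F) : F :=
  match x with
  | BLeaf => h (BNode y z)
  | BNode x1 x2 =>
      - tprod x1 x2 y (fun u => h (BNode u z))
      - sgn (bweight x1) * tprod x2 y z (fun u => h (BNode x1 u))
  end.

Lemma tprod_combination x y z : combination (tprod x y z).
Proof.
elim: x y z => [|x1 IH1 x2 IH2] y z; first exact: combination_eval.
have c1 := combination_bind (IH1 x2 y)
  (fun u => combination_eval (BNode u z)).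
have c2 := combination_bind (IH2 y z) (fun u => combination_eval (BNode x1 u)).
have [s E] := combinationD (combinationZ (-1) c1)
  (combinationZ (- sgn (bweight x1)) c2).
by exists s => h; rewrite /= -E; ring.
Qed.

(** The product is homogeneous: it adds one internal node. *)
Lemma eq_tprod x y z h h' :
    (forall u, bweight u = (bweight x + bweight y + bweight z).+1 ->
      h u = h' u) ->
  tprod x y z h = tprod x y z h'.
Proof.
elim: x y z h h' => [|x1 IH1 x2 IH2] y z h h' eq_h /=.
  by apply: eq_h => /=; lia.
congr (- _ - _ * _); [apply: IH1 | apply: IH2] => u uE;
  by apply: eq_h; rewrite /= uE; lia.
Qed.

(** The only critical pair of the rewriting is confluent.  For [a = BNode x y]
    the left-hand side is the identity for [x, y, b, c, d] placed to the left of
    [e], plus the identity for [y, b, c, d, e] placed to the right of [x], plus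
    two terms [(x y b) (c d e)] of opposite signs, since the sign of the first
    one counts the internal node of the product [x y b]. *)
Lemma tprod_partial_assoc a b c d e h :
  tprod a b c (fun u => tprod u d e h)
  + sgn (bweight a) * tprod b c d (fun u => tprod a u e h)
  + sgn (bweight a + bweight b) * tprod c d e (fun u => tprod a b u h) = 0.
Proof.
have tprodN x y z (s : F) k k' :
    tprod x y z (fun u => - k u - s * k' u) =
    - tprod x y z k - s * tprod x y z k'.
  rewrite -mulN1r -mulNr -combination_linear; last exact: tprod_combination.
  by apply: eq_tprod => u _; rewrite mulN1r mulNr.
elim: a b c d e h => [|x IHx y IHy] b c d e h.
  by rewrite /= /sgn expr0 add0n; ring.
(* The sign of the term [u (c d e)], for [u] in the product [x y b], is
   constant by homogeneity, so it can be taken out of that product. *)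
rewrite /= (@eq_tprod x y b _ (fun u =>
  - tprod u c d (fun w => h (BNode w e))
  - sgn (bweight x + bweight y + bweight b).+1 *
      tprod c d e (fun w => h (BNode u w)))); last by move=> u ->.
rewrite !tprodN (combination_exchange (fun u w => h (BNode u w))
  (tprod_combination x y b) (tprod_combination c d e)).
have /eqP := IHx y b c d (fun u => h (BNode u e)).
have /eqP := IHy b c d e (fun u => h (BNode x u)).
rewrite -!addrA !addr_eq0 => /eqP-> /eqP->.
by rewrite !addSn !sgnS !sgnD; ring.
Qed.

(** * Evaluation of ternary trees *)

Definition shift (k : nat) v : nat -> btree := fun j => v (k + j)%N.

Lemma shiftD k l v : shift k (shift l v) = shift (l + k) v.
Proof. by apply/funext => j; rewrite /shift addnA. Qed.

(** The inputs of [p] when those numbered [i, ..., i + m - 1] are consumed by a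
    tree grafted at leaf [i], whose value is [u]. *)
Definition plug v (i m : nat) (u : btree) : nat -> btree := fun j =>
  if (j < i)%N then v j else if j == i then u else v (j + m).-1.

(** The tree [p] applied to the binary trees [v 0, v 1, ...], as an element of V
    and without Koszul signs. *)
Fixpoint tree_eval (p : tree) (v : nat -> btree) (h : btree -> F) : F :=
  match p with
  | Leaf => h (v 0)
  | Node a b c =>
      tree_eval a v (fun x => tree_eval b (shift (arity a) v) (fun y =>
        tree_eval c (shift (arity a + arity b) v) (fun z => tprod x y z h)))
  end.

Lemma tree_eval_combination p v : combination (tree_eval p v).
Proof.
elim: p v => [|a IHa b IHb c IHc] v; first exact: combination_eval.
apply: combination_bind (IHa v) _ => x.
apply: combination_bind (IHb _) _ => y.
by apply: combination_bind (IHc _) _ => z; apply: tprod_combination.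
Qed.

Lemma eq_tree_eval p v v' h h' :
    (forall j, (j < arity p)%N -> v j = v' j) ->
    (forall u, bweight u = (weight p + \sum_(j < arity p) bweight (v j))%N ->
      h u = h' u) ->
  tree_eval p v h = tree_eval p v' h'.
Proof.
elim: p v v' h h' => [|a IHa b IHb c IHc] v v' h h' /= eq_v eq_h.
  by rewrite -eq_v // eq_h // big_ord1.
apply: IHa => [j lt_j | x wx]; first by apply: eq_v; lia.
apply: IHb => [j lt_j | y wy]; first by apply: eq_v; lia.
apply: IHc => [j lt_j | z wz]; first by apply: eq_v; lia.
apply: eq_tprod => u wu; apply: eq_h.
by rewrite wu wx wy wz !big_split_ord /= /shift; lia.
Qed.

Ltac plug_lia v :=
  rewrite /shift /plug; do ?[case: ifP => ?] => //; (try congr v); lia.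

Lemma tree_eval_graft p q v i h : (i < arity p)%N ->
  tree_eval (graft p i q) v h =
    tree_eval q (shift i v) (fun u => tree_eval p (plug v i (arity q) u) h).
Proof.
have q0 := arity_gt0 q.
elim: p v i h => [|a IHa b IHb c IHc] v i h lti; first by case: i lti.
have exch r w k : tree_eval r w (fun x => tree_eval q (shift i v) (k x)) =
    tree_eval q (shift i v) (fun u => tree_eval r w (k^~ u)).
  exact: combination_exchange (tree_eval_combination _ _)
    (tree_eval_combination _ _).
move: lti => /=; have [lt_ia _|le_ai] /= := ltnP i (arity a).
  rewrite IHa //; apply: eq_tree_eval => // u _; apply: eq_tree_eval => // x _.
  rewrite arity_graft; apply: eq_tree_eval => [j lt_j|y _]; first by plug_lia v.
  by apply: eq_tree_eval => [j lt_j|//]; plug_lia v.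
have plug_a u j : (j < arity a)%N -> plug v i (arity q) u j = v j.
  by move=> lt_j; rewrite /plug ifT //; lia.
have [lt_ib _|le_bi lt_ic] /= := ltnP i (arity a + arity b).
  transitivity (tree_eval a v (fun x => tree_eval q (shift i v) (fun u =>
    tree_eval b (shift (arity a) (plug v i (arity q) u)) (fun y =>
      tree_eval c (shift (arity a + arity b) (plug v i (arity q) u)) (fun z =>
        tprod x y z h))))).
    apply: eq_tree_eval => // x _; rewrite IHb ?shiftD ?subnKC //; last by lia.
    apply: eq_tree_eval => // u _.
    apply: eq_tree_eval => [j lt_j|y _]; first by plug_lia v.
    by rewrite arity_graft; apply: eq_tree_eval => [j lt_j|//]; plug_lia v.
  rewrite exch; apply: eq_tree_eval => // u _.
  by apply: eq_tree_eval => // j lt_j; rewrite plug_a.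
transitivity (tree_eval a v (fun x => tree_eval b (shift (arity a) v) (fun y =>
  tree_eval q (shift i v) (fun u =>
    tree_eval c (shift (arity a + arity b) (plug v i (arity q) u)) (fun z =>
      tprod x y z h))))).
  apply: eq_tree_eval => // x _; apply: eq_tree_eval => // y _.
  rewrite IHc; last by lia.
  rewrite shiftD -subnDA subnKC //; apply: eq_tree_eval => // u _.
  by apply: eq_tree_eval => // j lt_j; plug_lia v.
under eq_fun do rewrite exch.
rewrite exch; apply: eq_tree_eval => // u _.
apply: eq_tree_eval => [j lt_j|x _]; first by rewrite plug_a.
by apply: eq_tree_eval => // j lt_j; plug_lia v.
Qed.

Lemma tree_eval_ternary_of x h : tree_eval (ternary_of x) (fun=> BLeaf) h = h x.
Proof.
elim: x h => [|x IHx y IHy] h //=.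
by rewrite -[shift _ _]/(fun=> BLeaf) -[shift (1 + _) _]/(fun=> BLeaf) IHx IHy.
Qed.

(** The exponent of the sign of moving the inputs of [p] from behind the
    generators of [p], taken in preorder, to their leaves: the input at leaf [j]
    passes the generators that follow this leaf. *)
Definition koszul (p : tree) v : nat :=
  (\sum_(0 <= j < arity p) bweight (v j) * after p j)%N.

(** The last term is the sign of moving [q] past the inputs to its left; it
    depends on [q] only through its weight and on [p] not at all, so it is a
    common factor when [p] and [q] are replaced by homogeneous combinations. *)
Lemma koszul_graft p q v i u : (i < arity p)%N ->
    bweight u = (weight q + \sum_(j < arity q) bweight (shift i v j))%N ->
  (koszul (graft p i q) v + weight q * after p i =
    koszul q (shift i v) + koszul p (plug v i (arity q) u)
      + weight q * \sum_(j < i) bweight (v j))%N.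
Proof.
move=> lti wu; have q0 := arity_gt0 q.
(* Split the leaves into those left of, inside and right of the copy of [q]. *)
rewrite /koszul (@big_cat_nat _ _ _ i) ?arity_graft //=; last by lia.
rewrite (@big_cat_nat _ _ _ (i + arity q) i) /=; try lia.
rewrite [in RHS](@big_cat_nat _ _ _ i 0 (arity p)) //=; last by lia.
rewrite [X in _ = (_ + (_ + X) + _)%N]big_ltn //.
have -> : (\sum_(0 <= j < i) bweight (v j) * after (graft p i q) j)%N =
    (\sum_(0 <= j < i) bweight (plug v i (arity q) u j) * after p j
      + weight q * \sum_(j < i) bweight (v j))%N.
  rewrite !big_mkord big_distrr -big_split; apply: eq_bigr => j _.
  rewrite /= after_parl ?ltn_ord // /plug ltn_ord.
  by rewrite mulnDr [(weight q * _)%N]mulnC.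
have -> : (\sum_(i <= j < i + arity q)
      bweight (v j) * after (graft p i q) j)%N =
    (\sum_(0 <= j < arity q) bweight (shift i v j) * after q j
      + after p i * \sum_(j < arity q) bweight (shift i v j))%N.
  rewrite -{1}[i]add0n big_addn addKn big_distrr /=.
  rewrite -(big_mkord xpredT (fun j => after p i * bweight (shift i v j))%N).
  rewrite -big_split /=.
  apply: eq_big_nat => j /andP[_ lt_j].
  by rewrite addnC after_seq // /shift; nia.
have -> : (\sum_(i + arity q <= j < (arity p + arity q).-1)
      bweight (v j) * after (graft p i q) j)%N =
    (\sum_(i.+1 <= j < arity p)
      bweight (plug v i (arity q) u j) * after p j)%N.
  have -> : (i + arity q = i.+1 + (arity q).-1)%N by lia.
  rewrite big_addn.
  have -> : ((arity p + arity q).-1 - (arity q).-1 = arity p)%N by lia.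
  apply: eq_big_nat => j lt_j.
  have -> : (j + (arity q).-1 = (j + arity q).-1)%N by lia.
  by rewrite after_parr // /plug; do ?[case: ifP => ?]; lia.
have -> : plug v i (arity q) u i = u by rewrite /plug ltnn eqxx.
by rewrite wu; ring.
Qed.

Definition signed_eval n v h (f : LT F n) : F^o :=
  \sum_(p : tree_of n) f p * (sgn (koszul p v) * tree_eval p v h).

Lemma signed_eval_linear n v h : linear (@signed_eval n v h).
Proof.
move=> a f g; rewrite /signed_eval scaler_sumr -big_split.
by apply: eq_bigr => p _; rewrite !ffunE -[a *: f p]/(a * f p) mulrDl -mulrA.
Qed.

HB.instance Definition _ n v h := GRing.isLinear.Build F (LT F n) F^o _
  (@signed_eval n v h) (@signed_eval_linear n v h).

Lemma signed_eval_mono n (p : tree_of n) v h :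
  signed_eval v h (mono F p) = sgn (koszul p v) * tree_eval p v h.
Proof.
rewrite /signed_eval (bigD1 p) //= big1 => [|q /negPf neq_qp].
  by rewrite ffunE eqxx mul1r addr0.
by rewrite ffunE neq_qp mul0r.
Qed.

(** V is an algebra over the free operad: evaluation turns partial compositions
    into compositions of multilinear operations, up to a sign that depends on
    the arities and the inputs only. *)
Lemma signed_eval_pcomp m n (i : 'I_m) (f : LT F m) (g : LT F n) v h :
  signed_eval v h (pcomp i f g) =
  sgn (n./2 * \sum_(j < i) bweight (v j)) *
    signed_eval (shift i v) (fun u => signed_eval (plug v i n u) h f) g.
Proof.
rewrite /pcomp linear_sum /=; under eq_bigr do rewrite linear_sum /=.
rewrite exchange_big [in RHS]/signed_eval mulr_sumr; apply: eq_bigr => q _ /=.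
rewrite combination_sum; last exact: tree_eval_combination.
rewrite !mulr_sumr; apply: eq_bigr => p _.
rewrite linearZ /= signed_eval_mono.
have [Ep Eq] := (eqP (tvalP p), eqP (tvalP q)).
have lip : (i < arity p)%N by rewrite Ep.
have wq : n./2 = weight q by have := arityE q; rewrite Eq; lia.
have scaleE (a b : F) : a *: (b : F^o) = a * b by [].
rewrite scaleE wq tree_eval_graft // Eq /=.
set K := (weight q * \sum_(j < i) _)%N.
suff : sgn (weight q * after p i) * sgn (koszul (graft p i q) v) *
    tree_eval q (shift i v) (fun u => tree_eval p (plug v i n u) h) =
  sgn K * sgn (koszul q (shift i v)) *
    tree_eval q (shift i v)
      (fun u => sgn (koszul p (plug v i n u)) * tree_eval p (plug v i n u) h).
  by move=> E; rewrite -!/(sgn _); ring: E.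
have evalZ a k := combination_scale a k (tree_eval_combination q (shift i v)).
rewrite -!sgnD -[LHS]evalZ -[RHS]evalZ.
apply: eq_tree_eval => // u wu; rewrite mulrA -sgnD; congr (sgn _ * _).
by have := koszul_graft lip wu; rewrite Eq /K; lia.
Qed.

Lemma signed_eval_alpha v h : signed_eval v h (alpha F) = 0.
Proof.
rewrite /alpha /LTgen !pcomp_mono !linearD !linearZ /= !signed_eval_mono /=.
rewrite /koszul /= !big_nat_recr ?big_geq //= /sgn /shift /=.
rewrite !(muln0, addn0, mul1n, muln1, mul0n) /=.
rewrite !expr0 !scale1r mul1r.
exact: (tprod_partial_assoc (v 0) (v 1) (v 2) (v 3) (v 4) h).
Qed.

(** The elements all of whose evaluations vanish form an ideal: by
    [signed_eval_pcomp], an evaluation of a composition is, up to sign, an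
    evaluation of the inner factor, tested against a function whose values are
    evaluations of the outer factor. *)
Lemma ideal_signed_eval n (f : LT F n) v h :
  f \in ideal (alpha F) n -> signed_eval v h f = 0.
Proof.
have exU k : exists U : {vspace LT F k},
    forall f, f \in U <-> forall v h, signed_eval v h f = 0.
  apply: vspace_of_pred => [v' h'|a f1 f2 f1P f2P v' h']; first exact: linear0.
  by rewrite linearP /= f1P f2P scaler0 addr0.
pose S k := sval (cid (exU k)).
have SP k : forall f, f \in S k <-> _ := svalP (cid (exU k)).
have [_ _ least] := idealP (alpha F).
have: (ideal (alpha F) n <= S n)%VS; last first.
  by move=> /subvP sub /sub /SP.
apply: least => [k l a b /SP aP|]; last first.
  by apply/SP => v' h'; apply: signed_eval_alpha.
split=> i; apply/SP => v' h'; rewrite signed_eval_pcomp; last first.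
  by rewrite aP mulr0.
set g := (X in signed_eval _ X); have -> : g = (fun=> 0).
  by apply/funext => u; apply: aP.
rewrite /signed_eval [X in _ * X]big1 ?mulr0 // => q _.
have [s ->] := tree_eval_combination q (shift i v').
by rewrite big1 ?mulr0 // => c _; rewrite mulr0.
Qed.

(** * Normal trees are independent modulo the ideal *)

Definition normals n : {vspace LT F n} :=
  <<[seq mono F p | p <- enum [pred p : tree_of n | normal p]]>>%VS.

Lemma mono_normals n (p : tree_of n) : normal p -> mono F p \in normals n.
Proof. by move=> pN; rewrite memv_span ?map_f ?mem_enum. Qed.

Lemma normals_coef n (f : LT F n) (p : tree_of n) :
  f \in normals n -> ~~ normal p -> f p = 0.
Proof.
have [U UP] : exists U : {vspace LT F n},
    forall g, g \in U <-> (~~ normal p -> g p = 0).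
  apply: vspace_of_pred => [_|a g g' gP g'P pN]; first by rewrite ffunE.
  by rewrite !ffunE gP ?g'P // scaler0 addr0.
have /subvP sub : (normals n <= U)%VS; last by move=> /sub /UP.
apply/span_subvP => _ /mapP[q qN ->]; apply/UP => pN; rewrite ffunE.
by case: eqP pN => // ->; move: qN; rewrite mem_enum inE => ->.
Qed.

Lemma dim_normals n : \dim (normals n) = size (forests n 1).
Proof.
rewrite -card_normal; set A := [pred p : tree_of n | normal p].
rewrite /normals -[map _ _]/(val (map_tuple (@mono F n) (enum_tuple A))).
rewrite -[RHS](size_tuple (map_tuple (@mono F n) (enum_tuple A))).
apply/eqP/freeP => k k0 i.
move/ffunP/(_ (enum_val i)): k0; rewrite sum_ffunE ffunE (bigD1 i) //=.
have nthE (j : 'I_#|A|) :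
    [seq mono F p | p <- enum A]`_j = mono F (enum_val j).
  by rewrite (nth_map (enum_val j)) -?enum_val_nth // -cardE.
rewrite big1 => [|j neq_ji]; rewrite nthE !ffunE.
  by rewrite eqxx addr0 [_ *: _]mulr1.
by rewrite (inj_eq enum_val_inj) eq_sym (negPf neq_ji) scaler0.
Qed.

(** Evaluation at one-leaf trees, tested against the indicator function of the
    binary tree of [p], is the coefficient at [p] of a combination of normal
    trees. *)
Lemma ideal_normals0 n : (ideal (alpha F) n :&: normals n = 0)%VS.
Proof.
apply/eqP; rewrite -subv0; apply/subvP => f /memv_capP[fI fN]; rewrite memv0.
apply/eqP/ffunP => p; rewrite [RHS]ffunE.
have [pN|] := boolP (normal p); last exact: normals_coef fN.
have := ideal_signed_eval (fun=> BLeaf) (fun x => (ternary_of x == p)%:R) fI.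
rewrite /signed_eval (bigD1 p) //= big1 => [|q neq_qp].
  have [x Ex] := normalP pN; rewrite Ex tree_eval_ternary_of eqxx addr0 mulr1.
  by rewrite /koszul big1 ?mulr1.
have [/normalP[x Ex]|/(normals_coef fN)->] := boolP (normal q); last first.
  by rewrite mul0r.
rewrite {2}Ex tree_eval_ternary_of -Ex (inj_eq val_inj) (negPf neq_qp).
by rewrite !mulr0.
Qed.

(** * Every tree reduces to normal trees *)

(** The monomial of an untyped tree, in an arity that need not be definitionally
    its own; this keeps [reducible] free of casts. *)
Definition tree_mono n (p : tree) : LT F n :=
  [ffun q : tree_of n => (val q == p)%:R].

Definition reducible (p : tree) : bool :=
  tree_mono (arity p) p \in (ideal (alpha F) (arity p) + normals (arity p))%VS.

Lemma reducible_mono n (p : tree_of n) :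
  reducible p = (mono F p \in (ideal (alpha F) n + normals n)%VS).
Proof.
rewrite /reducible; have -> : mono F p = tree_mono n p by [].
by case: p => p /= /eqP->.
Qed.

Lemma normal_reducible p : normal p -> reducible p.
Proof.
move=> pN; rewrite (reducible_mono (TreeOf (eqxx (arity p)))).
by rewrite (subvP (addvSr _ _)) // mono_normals.
Qed.

(** Reduction is compatible with contexts: composition with [p] is linear, maps
    the ideal to itself, and maps the normal part of [q] to reducible trees by
    hypothesis. *)
Lemma reducible_graft p q i : (i < arity p)%N -> reducible q ->
    (forall r, normal r -> reducible (graft p i r)) ->
  reducible (graft p i q).
Proof.
move=> lti; pose P := TreeOf (eqxx (arity p)).
pose Q := TreeOf (eqxx (arity q)); pose j := Ordinal lti.
rewrite (reducible_mono Q) => /memv_addP[f fI [g gN fg]] red.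
rewrite (reducible_mono (graft_of j P Q)).
have -> : mono F (graft_of j P Q) =
    (-1) ^+ (weight Q * after P j) *: pcomp j (mono F P) (mono F Q).
  by rewrite pcomp_mono scalerA -expr2 sqrr_sign scale1r.
rewrite memvZ // fg -[f]scale1r pcomp_linearr scale1r memvD //.
  have [idI _ _] := idealP (alpha F).
  by rewrite (subvP (addvSl _ _)) // (idI _ _ _ _ fI).2.
rewrite (LT_sum g).
pose lin := GRing.isLinear.Build _ _ _ _ _
  (@pcomp_linearr F _ (arity q) j (mono F P)).
pose phi : {linear _ -> _} := HB.pack (pcomp j (mono F P)) lin.
rewrite -[pcomp _ _ _]/(phi _) linear_sum memv_suml // => r _.
have [rN|/(normals_coef gN)->] := boolP (normal r); last first.
  by rewrite scale0r linear0 mem0v.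
rewrite linearZ memvZ //= pcomp_mono memvZ //.
by rewrite -(reducible_mono (graft_of j P r)) red.
Qed.

(** The signs are left unspecified because grafting changes them, in a way that
    is immaterial for rewriting [p1] in terms of [p2] and [p3]. *)
Definition related n (p1 p2 p3 : tree_of n) : Prop :=
  exists s1 s2 s3, sgn s1 *: mono F p1 + sgn s2 *: mono F p2
    + sgn s3 *: mono F p3 \in ideal (alpha F) n.

Lemma related_graft n m (i : 'I_n) (q : tree_of m) (p1 p2 p3 : tree_of n) :
  related p1 p2 p3 ->
  related (graft_of i p1 q) (graft_of i p2 q) (graft_of i p3 q).
Proof.
have [idI _ _] := idealP (alpha F).
case=> s1 [s2 [s3 /(idI _ _ _ (mono F q))[/(_ i) relI _]]].
pose s p := (weight q * after p i)%N.
exists (s1 + s p1)%N, (s2 + s p2)%N, (s3 + s p3)%N; move: relI.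
rewrite -addrA pcomp_linearl pcomp_linearl.
rewrite (GRing.scalable_linear (pcomp_linearl i _)).
by rewrite /= !pcomp_mono !scalerA -!exprD addrA.
Qed.

Lemma reducible_related n (p1 p2 p3 : tree_of n) :
  related p1 p2 p3 -> reducible p2 -> reducible p3 -> reducible p1.
Proof.
rewrite !reducible_mono => -[s1 [s2 [s3 relI]]] red2 red3.
have -> : mono F p1 = sgn s1 *: (sgn s1 *: mono F p1).
  by rewrite scalerA -expr2 sqrr_sign scale1r.
rewrite memvZ // -[X in X \in _](addrK
  (sgn s2 *: mono F p2 + sgn s3 *: mono F p3)).
rewrite memvB //; last by rewrite memvD ?memvZ.
by rewrite addrA (subvP (addvSl _ _)).
Qed.

(** One rewriting step at the root: the three terms of [alpha], with [a], [b],
    [c], [d] grafted at the leaves 1 to 4. *)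
Lemma reducible_rewrite a b c d :
    reducible (Node Leaf (Node a b c) d) ->
    reducible (Node Leaf a (Node b c d)) ->
  reducible (Node (Node Leaf a b) c d).
Proof.
pose t := @TreeOf 3 (Node Leaf Leaf Leaf) isT.
have rel : related (graft_of 0 t t) (graft_of 1 t t) (graft_of 2 t t).
  have [_ alphaI _] := idealP (alpha F).
  exists 0%N, 0%N, 0%N; rewrite /sgn expr0 !scale1r.
  by move: alphaI; rewrite /alpha /LTgen !pcomp_mono /= !scale1r.
pose T (p : tree) : tree_of (arity p) := TreeOf (eqxx (arity p)).
have lt k m (p : tree) : (k < m)%N -> (k < (m + arity p).-1)%N.
  by have := arity_gt0 p; lia.
(* Grafting from right to left keeps the numbers of the remaining leaves. *)
have rel4 := related_graft (Ordinal (isT : 4 < 5)%N) (T d) rel.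
have lt3 := lt 3 5 d isT.
have rel3 := related_graft (Ordinal lt3) (T c) rel4.
have lt2 := lt 2 _ c (lt 2 5 d isT).
have rel2 := related_graft (Ordinal lt2) (T b) rel3.
have lt1 := lt 1 _ b (lt 1 _ c (lt 1 5 d isT)).
exact: reducible_related (related_graft (Ordinal lt1) (T a) rel2).
Qed.

Lemma reducible_child1 a b c : reducible a ->
  (forall r, normal r -> reducible (Node r b c)) -> reducible (Node a b c).
Proof. by move=> aR red; apply: (@reducible_graft (Node Leaf b c) a 0). Qed.

Lemma reducible_child2 a b c : reducible b ->
  (forall r, normal r -> reducible (Node a r c)) -> reducible (Node a b c).
Proof.
have graftE r : graft (Node a Leaf c) (arity a) r = Node a r c.
  by rewrite /= ltnn addn1 ltnSn.
move=> bR red; rewrite -graftE; apply: reducible_graft => //= [|r rN].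
  by have := arity_gt0 c; lia.
by rewrite -/(graft (Node a Leaf c) _ _) graftE red.
Qed.

Lemma reducible_child3 a b c : reducible c ->
  (forall r, normal r -> reducible (Node a b r)) -> reducible (Node a b c).
Proof.
have graftE r : graft (Node a b Leaf) (arity a + arity b) r = Node a b r.
  by rewrite /= ltnn ltnNge leq_addr.
move=> cR red; rewrite -graftE; apply: reducible_graft => // [|r rN].
  by rewrite /= addn1.
by rewrite graftE red.
Qed.

(** Rewriting terminates because both terms of a rewriting step have a smaller
    tree as the first child of the node where the next step may occur. *)
Lemma reducible_node_normal a b c :
  normal a -> normal b -> normal c -> reducible (Node a b c).
Proof.
elim: a b c => [|[|//] _ x IHx y IHy] b c /=.
  by move=> _ bN cN; apply: normal_reducible; rewrite /= bN.
case/andP=> xN yN bN cN; apply: reducible_rewrite.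
  apply: reducible_child2 => [|r rN]; first exact: IHx.
  by apply: normal_reducible; rewrite /= rN.
apply: reducible_child3 => [|r rN]; first exact: IHy.
by apply: normal_reducible; rewrite /= xN.
Qed.

Lemma all_reducible p : reducible p.
Proof.
elim: p => [|a aR b bR c cR]; first exact: normal_reducible.
apply: reducible_child1 => // x xN; apply: reducible_child2 => // y yN.
by apply: reducible_child3 => // z zN; apply: reducible_node_normal.
Qed.

Lemma ideal_normals_full n : (ideal (alpha F) n + normals n = fullv)%VS.
Proof.
apply/eqP; rewrite eqEsubv subvf; apply/subvP => f _; rewrite (LT_sum f).
by apply: memv_suml => p _; rewrite memvZ // -reducible_mono all_reducible.
Qed.

Lemma dim_LTquot n : \dim {: LTquot F n} = size (forests n 1).
Proof.
rewrite dim_quotv -dim_normals -(ideal_normals_full n).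
by rewrite dimv_disjoint_sum ?ideal_normals0 // addKn.
Qed.

End Model.

Theorem theorem3p14 (F : fieldType) (hF : [pchar F] =i pred0) (w : nat) :
  (\dim {: LTquot F (2 * w).+1})%:R
    = (w.+1%:R)^-1 * ('C(2 * w, w))%:R :> rat.
Proof.
rewrite dim_LTquot -catalan natrM mulKf //.
by rewrite Num.Theory.pnatr_eq0.
Qed.
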